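(* Let $\mathfrak{B}_{\mathbb{R}}=\mathfrak{b}\oplus T\mathbb{R}$ and $\mathfrak{A}_{\mathbb{R}}$ be the Lie algebroids over $\mathbb{R}$ described in the context, and pair the two vector bundles by declaring the frame $(J_0,J_1,J_2,J_3)$ of $\mathfrak{A}_{\mathbb{R}}$ to be dual to the frame $(\hat J_0,\hat J_1,\hat J_2,\hat J_3)$ of $\mathfrak{B}_{\mathbb{R}}$, so that $\langle J_i,\hat J_j\rangle=\delta_{ij}$ and each bundle is identified with the dual of the other. Then this pairing makes $\mathfrak{A}_{\mathbb{R}}$ and $\mathfrak{B}_{\mathbb{R}}$ into (mutually dual) Lie bialgebroids.
   Context: A Lie algebroid over a smooth manifold $\mathscr{O}$ is a vector bundle $A\to\mathscr{O}$ with a vector bundle map $\rho:A\to T\mathscr{O}$ (the anchor) and a Lie bracket on $\Gamma(A)$ such that $[X,fY]=f[X,Y]+\rho(X)(f)Y$ for $X,Y\in\Gamma(A)$, $f\in C^\infty(\mathscr{O})$. The bracket of a Lie algebroid $A$ extends to a Gerstenhaber bracket on $\Gamma(\Lambda A)$, with $[X,f]=\rho(X)(f)$ and $[X,Y\wedge Z]=[X,Y]\wedge Z+Y\wedge[X,Z]$. A Lie bialgebroid is a Lie algebroid $(A,\mathscr{O},\rho)$ together with a Lie algebroid structure, with anchor $\rho_*$, on the dual bundle $A^*$, such that the map $\delta:\Gamma(A)\to\Gamma(\Lambda^2A)$ defined by $$\delta(X)(\xi,\eta)=\langle X,[\xi,\eta]\rangle-\rho_*(\xi)(\langle X,\eta\rangle)+\rho_*(\eta)(\langle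 X,\xi\rangle),\qquad \xi,\eta\in\Gamma(A^* ),$$ satisfies $\delta([X,Y])=[\delta(X),Y]+[X,\delta(Y)]$ for all $X,Y\in\Gamma(A)$. Here $(X\wedge Y)(\xi,\eta)=\langle X,\xi\rangle\langle Y,\eta\rangle-\langle X,\eta\rangle\langle Y,\xi\rangle$. The dual of a Lie bialgebroid is obtained by interchanging $(A,\mathscr{O},\rho)$ and $(A^*,\mathscr{O},\rho_* )$. The Lie algebra $\mathfrak{b}$ is the three-dimensional real Lie algebra with basis $\hat J_1,\hat J_2,\hat J_3$ and brackets $[\hat J_1,\hat J_2]=\hat J_2$, $[\hat J_1,\hat J_3]=\hat J_3$, $[\hat J_2,\hat J_3]=0$. The Lie algebroid $\mathfrak{B}_{\mathbb{R}}=\mathfrak{b}\oplus T\mathbb{R}$ over $\mathbb{R}$ is the direct sum of the trivial bundle of Lie algebras with fibre $\mathfrak{b}$ (zero anchor, pointwise bracket of constant sections) and the tangent Lie algebroid $T\mathbb{R}$; its anchor is $\hat\rho:(a,t)\mapsto t$, and constant sections of $\mathfrak b$ commute with $\frac{\partial}{\partial y}$. Its frame is $\hat J_i=(\hat J_i,0)$ for $i\in\{1,2,3\}$ and $\hat J_0=(0,2\frac{\partial}{\partial y})$, where $y$ is the coordinate on $\mathbb{R}$. For $y\in\mathbb{R}$, $\mathfrak{su}_{\mathrm{ext}}^{(y)}(2)$ is the four-dimensional real Lie algebra with basis $J_0^{(y)},\dots,J_3^{(y)}$, with $J_0^{(y)}$ central and $[J_1^{(y)},J_2^{(y)}]=2J_3^{(y)}$,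 $[J_2^{(y)},J_3^{(y)}]=2yJ_1^{(y)}+2J_0^{(y)}$, $[J_3^{(y)},J_1^{(y)}]=2J_2^{(y)}$. The Lie algebroid $\mathfrak{A}_{\mathbb{R}}$ is the trivial vector bundle over $\mathbb{R}$ with fibre $\mathfrak{su}_{\mathrm{ext}}^{(y)}(2)$ at $y$, zero anchor and fibrewise bracket; its frame of constant sections is $J_i:y\mapsto J_i^{(y)}$, $i=0,1,2,3$. *)

(* Defs.v *)
From HB Require Import structures.
From mathcomp Require Import all_boot all_order all_algebra.
From mathcomp Require Import all_classical all_reals all_analysis.
Import Order.TTheory GRing.Theory Num.Theory.
Import numFieldNormedType.Exports.
Set Implicit Arguments.
Unset Strict Implicit.
Unset Printing Implicit Defensive.
Local Open Scope ring_scope.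
Local Open Scope classical_set_scope.

Definition smooth (R : realType) (f : R -> R) : Prop :=
  forall (n : nat) (x : R), derivable (derive1n n f) x 1.

Definition smooth_pred (R : realType) : {pred (R -> R)} :=
  fun f => `[< smooth f >].
Arguments smooth_pred R : clear implicits.

Section SmoothClosure.
Variable R : realType.
Implicit Types f g : R -> R.

Lemma smooth_deriv f : smooth f -> smooth (derive1 f).
Proof. by move=> sf n x; rewrite -derive1Sn. Qed.

Lemma smoothS f : (forall x, derivable f x 1) -> smooth (derive1 f) -> smooth f.
Proof. by move=> df sf [//|n] x; rewrite derive1Sn. Qed.

Lemma smooth_cst (c : R) : smooth (cst c : R -> R).
Proof.
move=> n; elim: n c => [|n IH] c x; first exact: derivable_cst.
rewrite derive1Sn; suff -> : derive1 (cst c : R -> R) = cst 0 by exact: IH.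
by apply/funext => t; rewrite derive1_cst.
Qed.

Lemma smooth_id : smooth (id : R -> R).
Proof.
apply: smoothS => [x|]; first exact: derivable_id.
suff -> : derive1 (id : R -> R) = cst 1 by exact: smooth_cst.
by apply/funext => t; rewrite derive1_id.
Qed.

Lemma smoothB f g : smooth f -> smooth g -> smooth (f - g).
Proof.
move=> sf sg n; elim: n f g sf sg => [|n IH] f g sf sg x.
  by apply: derivableB; [exact: (sf 0%N)|exact: (sg 0%N)].
rewrite derive1Sn; suff -> : derive1 (f - g) = derive1 f - derive1 g.
  by apply: IH; exact: smooth_deriv.
apply/funext => t; rewrite derive1E deriveB ?fctE ?derive1E //.
  exact: (sf 0%N).
exact: (sg 0%N).
Qed.

Lemma derive1_mul f g : (forall x, derivable f x 1) ->
  (forall x, derivable g x 1) -> derive1 (f * g) = f * derive1 g + derive1 f * g.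
Proof.
move=> df dg; apply/funext => t; rewrite derive1E deriveM // !fctE !derive1E.
by congr (_ + _); rewrite /GRing.scale /= mulrC.
Qed.

Let upto n f := forall k, (k <= n)%N -> forall x, derivable (derive1n k f) x 1.

Let uptoP n f : upto n.+1 f <-> (forall x, derivable f x 1) /\ upto n (derive1 f).
Proof.
split=> [uf|[df uf] [|k] kn x]; last 2 first.
- exact: df.
- by rewrite derive1Sn; exact: uf.
by split=> [x|k kn x]; [exact: (uf 0%N)|rewrite -derive1Sn; exact: uf].
Qed.

Let uptoD n f g : upto n f -> upto n g -> upto n (f + g).
Proof.
elim: n f g => [|n IH] f g.
  move=> uf ug [|//] _ x.
  by apply: derivableD; [exact: (uf 0%N)|exact: (ug 0%N)].
move=> /uptoP[df uf] /uptoP[dg ug]; apply/uptoP; split=> [x|].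
  by apply: derivableD; [exact: df|exact: dg].
suff -> : derive1 (f + g) = derive1 f + derive1 g by exact: IH.
apply/funext => t; rewrite derive1E deriveD ?fctE ?derive1E //.
Qed.

Let uptoM n f g : upto n f -> upto n g -> upto n (f * g).
Proof.
elim: n f g => [|n IH] f g.
  move=> uf ug [|//] _ x.
  by apply: derivableM; [exact: (uf 0%N)|exact: (ug 0%N)].
move=> uf ug; have [df uf'] := (uptoP n f).1 uf.
have [dg ug'] := (uptoP n g).1 ug.
apply/uptoP; split=> [x|]; first by apply: derivableM; [exact: df|exact: dg].
have uW h : upto n.+1 h -> upto n h by move=> uh k kn; apply: uh; exact: leqW.
rewrite derive1_mul //; apply: uptoD; apply: IH => //; exact: uW.
Qed.

Lemma smoothM f g : smooth f -> smooth g -> smooth (f * g).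
Proof.
move=> sf sg n x; apply: (uptoM (n := n)) => // k _ y.
Qed.

Lemma smooth_subring : subring_closed (smooth_pred R).
Proof.
split.
- by apply/asboolP; exact: smooth_cst.
- by move=> f g /asboolP sf /asboolP sg; apply/asboolP; exact: smoothB.
- by move=> f g /asboolP sf /asboolP sg; apply/asboolP; exact: smoothM.
Qed.

HB.instance Definition _ :=
  GRing.isSubringClosed.Build _ (smooth_pred R) smooth_subring.

End SmoothClosure.

(* The ring of smooth functions on the manifold R. *)
Record Cinf (R : realType) := MkCinf {
  Cinf_fun :> R -> R ;
  Cinf_smooth : Cinf_fun \in smooth_pred R }.

HB.instance Definition _ (R : realType) := [isSub for @Cinf_fun R].
HB.instance Definition _ (R : realType) := [Choice of Cinf R by <:].
HB.instance Definition _ (R : realType) :=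
  [SubChoice_isSubComNzRing of Cinf R by <:].

Section Functions.
Variable R : realType.

Lemma Cinf_const_subproof (c : R) : (cst c : R -> R) \in smooth_pred R.
Proof. by apply/asboolP; exact: smooth_cst. Qed.
Definition Cconst (c : R) : Cinf R := MkCinf (Cinf_const_subproof c).

Lemma Cinf_coord_subproof : (id : R -> R) \in smooth_pred R.
Proof. by apply/asboolP; exact: smooth_id. Qed.
Definition ycoord : Cinf R := MkCinf Cinf_coord_subproof.

Lemma Cinf_dy_subproof (f : Cinf R) : derive1 (f : R -> R) \in smooth_pred R.
Proof. by apply/asboolP/smooth_deriv/asboolP; exact: Cinf_smooth. Qed.
Definition dy (f : Cinf R) : Cinf R := MkCinf (Cinf_dy_subproof f).

Definition evalC (y : R) (f : Cinf R) : R := f y.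

End Functions.

(* All bundles are trivial bundles R x R^n over the line.  A section is a row
   of n smooth functions, and a vector bundle map over the identity is a smooth
   family of matrices. *)
Notation sect R n := 'rV[Cinf R]_n.

(* TR is trivialised by d/dy, so the anchor is a smooth family of linear forms
   on the fibre. *)
Record algebroid (R : realType) (n : nat) := Algebroid {
  anchor : 'cV[Cinf R]_n ;
  bracket : sect R n -> sect R n -> sect R n }.

Definition rho (R : realType) (n : nat) (A : algebroid R n) (X : sect R n)
  (f : Cinf R) : Cinf R := (X *m anchor A) 0 0 * dy f.

Record is_lie_algebroid (R : realType) (n : nat) (A : algebroid R n) : Prop :=
  IsLieAlgebroid {
    bracket_linear : forall (c : R) (X Y Z : sect R n),
      bracket A (Cconst c *: X + Y) Z
        = Cconst c *: bracket A X Z + bracket A Y Z ;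
    bracket_alternating : forall X : sect R n, bracket A X X = 0 ;
    bracket_jacobi : forall X Y Z : sect R n,
      bracket A X (bracket A Y Z) + bracket A Y (bracket A Z X)
        + bracket A Z (bracket A X Y) = 0 ;
    bracket_leibniz : forall (X Y : sect R n) (f : Cinf R),
      bracket A X (f *: Y) = f *: bracket A X Y + rho A X f *: Y }.

(* A pairing of two bundles is a smooth family of bilinear forms on the fibres;
   when it is nondegenerate on every fibre it identifies each bundle with the
   dual of the other. *)
Definition pairing (R : realType) (n : nat) (P : 'M[Cinf R]_n)
  (X xi : sect R n) : Cinf R := (X *m P *m xi^T) 0 0.

Definition nondegenerate (R : realType) (n : nat) (P : 'M[Cinf R]_n) : Prop :=
  forall y : R, map_mx (evalC y) P \in unitmx.

(* Sections of Lambda^2 A, viewed as in the formula for X /\ Y as alternating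
   function-bilinear forms on the sections of A^*. *)
Definition form2 (R : realType) (n : nat) := sect R n -> sect R n -> Cinf R.

Definition is_bivector (R : realType) (n : nat) (w : form2 R n) : Prop :=
  (forall (f : Cinf R) (xi eta zeta : sect R n),
     w (f *: xi + eta) zeta = f * w xi zeta + w eta zeta) /\
  (forall xi : sect R n, w xi xi = 0).

Definition wedge (R : realType) (n : nat) (P : 'M[Cinf R]_n)
  (X Y : sect R n) : form2 R n :=
  fun xi eta => pairing P X xi * pairing P Y eta - pairing P X eta * pairing P Y xi.

(* D X w stands for the Gerstenhaber bracket [X, w] of a section X of A and a
   section w of Lambda^2 A.  Bivectors being sums of decomposable ones, D is
   determined on them by these conditions. *)
Definition extends_bracket (R : realType) (n : nat) (P : 'M[Cinf R]_n)
  (A : algebroid R n) (D : sect R n -> form2 R n -> form2 R n) : Prop :=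
  [/\ forall (X : sect R n) (w : form2 R n),
        is_bivector w -> is_bivector (D X w),
      forall (X : sect R n) (v w : form2 R n),
        is_bivector v -> is_bivector w ->
        forall xi eta : sect R n,
          D X (fun a b => v a b + w a b) xi eta = D X v xi eta + D X w xi eta
    & forall X Y Z xi eta : sect R n,
        D X (wedge P Y Z) xi eta
          = wedge P (bracket A X Y) Z xi eta + wedge P Y (bracket A X Z) xi eta].

(* B carries the Lie algebroid structure on A^*. *)
Definition delta (R : realType) (n : nat) (P : 'M[Cinf R]_n)
  (B : algebroid R n) (X : sect R n) : form2 R n :=
  fun xi eta => pairing P X (bracket B xi eta)
    - rho B xi (pairing P X eta) + rho B eta (pairing P X xi).

(* By graded antisymmetry of the Gerstenhaber bracket, [w, Y] = - [Y, w] for a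
   bivector w and a section Y. *)
Definition lie_bialgebroid (R : realType) (n : nat) (P : 'M[Cinf R]_n)
  (A B : algebroid R n) : Prop :=
  [/\ is_lie_algebroid A,
      is_lie_algebroid B,
      nondegenerate P
    & exists D : sect R n -> form2 R n -> form2 R n,
        extends_bracket P A D /\
        forall X Y xi eta : sect R n,
          delta P B (bracket A X Y) xi eta
            = - D Y (delta P B X) xi eta + D X (delta P B Y) xi eta].

(* The bracket of su_ext^(y)(2) in the basis J_0, ..., J_3, over any
   commutative ring K: K = R gives a single fibre, and K = Cinf R with y the
   coordinate function gives the fibrewise bracket of sections
   (su_bracket_fibre below). *)
Definition su_bracket (K : comNzRingType) (y : K) (u v : 'rV[K]_4) : 'rV[K]_4 :=
  let c (i j : 'I_4) := u 0 i * v 0 j - u 0 j * v 0 i in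
  let i1 := inord 1 : 'I_4 in
  let i2 := inord 2 : 'I_4 in
  let i3 := inord 3 : 'I_4 in
  \row_k [:: 2%:R * c i2 i3; 2%:R * y * c i2 i3;
             2%:R * c i3 i1; 2%:R * c i1 i2]`_k.

Definition A_R (R : realType) : algebroid R 4 :=
  {| anchor := 0 ; bracket := su_bracket (ycoord R) |}.

Lemma su_bracket_fibre (R : realType) (X Y : sect R 4) (y : R) :
  map_mx (evalC y) (bracket (A_R R) X Y)
    = su_bracket y (map_mx (evalC y) X) (map_mx (evalC y) Y).
Proof.
apply/rowP => -[k k4]; rewrite !mxE /=.
by case: k k4 => [|[|[|[|k]]]].
Qed.

(* The bracket of b, position k (k = 0, 1, 2) being the coordinate along
   Jhat_{k+1}. *)
Definition b_bracket (K : comNzRingType) (u v : 'rV[K]_3) : 'rV[K]_3 :=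
  let c (i j : 'I_3) := u 0 i * v 0 j - u 0 j * v 0 i in
  let i1 := inord 0 : 'I_3 in
  let i2 := inord 1 : 'I_3 in
  let i3 := inord 2 : 'I_3 in
  \row_k [:: 0; c i1 i2; c i1 i3]`_k.

(* A section of b + TR is a pair (a, t d/dy), stored as row_mx a t.  Since
   constant sections of b commute with d/dy, the Leibniz rule gives
     [(a, t d/dy), (b, s d/dy)] = ([a, b] + t b' - s a', (t s' - s t') d/dy). *)
Definition B_R (R : realType) : algebroid R (3 + 1) :=
  {| anchor := col_mx 0 1%:M ;
     bracket := fun X Y : sect R (3 + 1) =>
       let a := lsubmx X in
       let t := rsubmx X 0 0 in
       let b := lsubmx Y in
       let s := rsubmx Y 0 0 in
       row_mx (b_bracket a b + t *: map_mx (@dy R) b - s *: map_mx (@dy R) a)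
              (t * dy s - s * dy t)%:M |}.

Definition J (R : realType) (i : 'I_4) : sect R 4 := delta_mx 0 i.

(* Jhat_0 = (0, 2 d/dy), and Jhat_{k+1} is the k-th basis vector of b. *)
Definition Jhat (R : realType) (i : 'I_4) : sect R (3 + 1) :=
  if unlift ord0 i is Some k then row_mx (delta_mx 0 k) 0
  else row_mx 0 2%:M.

Definition frames_dual (R : realType) (P : 'M[Cinf R]_4) : Prop :=
  forall i j : 'I_4, pairing P (J R i) (Jhat R j) = (i == j)%:R.

(* Main.v *)
From HB Require Import structures.
Require Import Defs.
From mathcomp Require Import all_boot all_order all_algebra.
From mathcomp Require Import all_classical all_reals all_analysis.
From mathcomp Require Import ring.
Import GRing.Theory.
Local Open Scope ring_scope.

(** Why the two algebroids form a Lie bialgebroid.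

    The duality of the frames is the single matrix equation P *m Jhat_mx = 1,
    where the columns of Jhat_mx are the sections Jhat_j; Jhat_mx is invertible
    because 2 is, so P exists, is unique, and is nondegenerate
    ([frames_dualE], [frame_pairing_dual], [frames_dual_unique]).

    For a section X of a Lie algebroid A, the Leibniz rule makes
    Y |-> rho(X)<Y, xi> - <[X, Y], xi> linear over functions, so it is
    represented by a section L_X xi of the dual bundle
    ([dual_action_exists]).  The bracket [X, w] with a bivector w is then
    the Lie derivative
      [X, w](xi, eta) = rho(X)(w(xi, eta)) - w(L_X xi, eta) - w(xi, L_X eta).
    A map that satisfies the conditions of [is_bivector] need not be
    antisymmetric, so w is first replaced by its alternating part, which is w
    itself when w is antisymmetric ([alt_part_id]); delta X always is.
    Hence a pair of Lie algebroids in duality is a Lie bialgebroid as soon as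
    delta is a cocycle for the Lie derivative ([lie_bialgebroid_criterion]).

    It remains to compute.  In the coordinates given by the frames J and Jhat the
    pairing is the standard one, and L and delta are, for X = sum x_i J_i,
    xi = sum u_i Jhat_i, eta = sum v_i Jhat_i and y the coordinate,
      L_X xi = 2 (x2 u3 - x3 u2) Jhat_1 + 2 (x3 (u0 + y u1) - x1 u3) Jhat_2
               + 2 (x1 u2 - x2 (u0 + y u1)) Jhat_3,
      delta(X)(xi, eta) = x2 (u1 v2 - u2 v1) + x3 (u1 v3 - u3 v1)
               - 2 sum_(i > 0) x_i' (u0 v_i - u_i v0),
    with similar formulas for the dual pair.  The axioms of both algebroids and
    both cocycle identities thereby become identities between polynomials in the
    coordinates and their derivatives.  On the frame the decisive
    case is that of J_2 and J_3: the derivative of y in delta(2 y J_1 + 2 J_0)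
    gives 4 J_1 /\ J_0, and so does [delta J_2, J_3] + [J_2, delta J_3], through
    the central term of [J_2, J_3]. *)

(** * The derivation d/dy of the ring of smooth functions *)

Section Derivation.
Variable R : realType.
Implicit Types f g : Cinf R.

Lemma Cinf_derivable f (x : R) : derivable (f : R -> R) x 1.
Proof. by have /asboolP sf := Cinf_smooth f; exact: (sf 0%N). Qed.

Lemma dyB f g : dy (f - g) = dy f - dy g.
Proof.
apply/val_inj/funext => t /=.
by rewrite derive1E deriveB -?derive1E //; exact: Cinf_derivable.
Qed.

Lemma dyM f g : dy (f * g) = f * dy g + dy f * g.
Proof.
by apply/val_inj; rewrite /= derive1_mul // => x; exact: Cinf_derivable.
Qed.

Lemma dy_const (c : R) : dy (Cconst c) = 0.
Proof. by apply/val_inj/funext => t; rewrite [LHS]derive1_cst. Qed.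

Lemma dy_ycoord : dy (ycoord R) = 1.
Proof. by apply/val_inj/funext => t; rewrite [LHS]derive1_id. Qed.

Lemma dy0 : dy (0 : Cinf R) = 0.
Proof. by rewrite -[X in dy X](subrr 0) dyB subrr. Qed.

Lemma dyN f : dy (- f) = - dy f.
Proof. by rewrite -sub0r dyB dy0 sub0r. Qed.

Lemma dyD f g : dy (f + g) = dy f + dy g.
Proof. by rewrite -{1}(opprK g) dyB dyN opprK. Qed.

Lemma dy1 : dy (1 : Cinf R) = 0.
Proof.
by have := dyM 1 1; rewrite !mulr1 mul1r => /(canLR (addrK _)); rewrite subrr.
Qed.

Lemma dy_nat n : dy (n%:R : Cinf R) = 0.
Proof. by elim: n => [|n IH]; rewrite ?dy0 // mulrS dyD dy1 IH addr0. Qed.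

Definition dyE :=
  (dyD, dyB, dyN, dyM, dy_nat, dy0, dy1, dy_const, dy_ycoord).

Lemma evalC_zmod_morphism y : zmod_morphism (@evalC R y).
Proof. by []. Qed.

Lemma evalC_monoid_morphism y : monoid_morphism (@evalC R y).
Proof. by []. Qed.

HB.instance Definition _ y :=
  GRing.isZmodMorphism.Build _ _ (@evalC R y) (evalC_zmod_morphism y).
HB.instance Definition _ y :=
  GRing.isMonoidMorphism.Build _ _ (@evalC R y) (evalC_monoid_morphism y).

Lemma Cconst1 : Cconst (1 : R) = 1.
Proof. exact/val_inj/funext. Qed.

Lemma Cconst_half : Cconst (2%:R^-1 : R) * 2%:R = 1.
Proof.
apply/val_inj/funext => t; rewrite rmorphM rmorph_nat /=.
have -> : (2%:R : R -> R) = cst 2%:R by apply/funext => u; rewrite mulr2n.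
by rewrite [LHS]mulVf.
Qed.

End Derivation.

(** The pairings and the derivatives along anchors are made into variables, from
    the innermost outwards: comparing them as atoms up to conversion makes [ring]
    unfold smooth functions. *)
Ltac ring_atoms :=
  repeat match goal with |- context [pairing ?P ?X ?Y] =>
    let a := fresh in move: (pairing P X Y) => a end;
  repeat match goal with |- context [rho ?A ?X ?f] =>
    let a := fresh in move: (rho A X f) => a end;
  ring.

(** Decides identities between differential polynomials, by treating the
    derivatives of the indeterminates as further indeterminates. *)
Ltac differential_ring :=
  rewrite ?dyE;
  repeat match goal with |- context [dy ?f] =>
    let a := fresh in move: (dy f) => a end;
  ring.

Definition skew_symmetric {V W : zmodType} (b : V -> V -> W) :=
  forall x y, b x y = - b y x.

(** * Lie derivatives of bivectors *)

Section LieDerivative.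
Variables (R : realType) (n : nat).
Local Notation K := (Cinf R).
Implicit Types (P Q : 'M[K]_n) (A B : algebroid R n) (X Y Z xi eta : sect R n).

Lemma pairingDl P X Y xi :
  pairing P (X + Y) xi = pairing P X xi + pairing P Y xi.
Proof. by rewrite /pairing !mulmxDl mxE. Qed.

Lemma pairingZl P f X xi : pairing P (f *: X) xi = f * pairing P X xi.
Proof. by rewrite /pairing -!scalemxAl mxE. Qed.

Lemma pairingDr P X xi eta :
  pairing P X (xi + eta) = pairing P X xi + pairing P X eta.
Proof. by rewrite /pairing linearD mulmxDr mxE. Qed.

Lemma pairingZr P f X xi : pairing P X (f *: xi) = f * pairing P X xi.
Proof. by rewrite /pairing linearZ -scalemxAr mxE. Qed.

Lemma pairing_tr P X xi : pairing P^T xi X = pairing P X xi.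
Proof.
rewrite /pairing; have -> : xi *m P^T *m X^T = (X *m P *m xi^T)^T.
  by rewrite !trmx_mul trmxK mulmxA.
by rewrite mxE.
Qed.

Lemma pairing_inj P Q xi eta : P *m Q = 1%:M ->
  (forall Y, pairing P Y xi = pairing P Y eta) -> xi = eta.
Proof.
move=> /mulmx1C QP eqP; apply: trmx_inj.
rewrite -[LHS]mul1mx -[RHS]mul1mx -QP -!mulmxA; congr mulmx.
apply/colP => i; have := eqP (delta_mx 0 i).
by rewrite /pairing -!mulmxA -!rowE !mxE.
Qed.

Lemma right_inverse_nondegenerate P Q :
  P *m Q = 1%:M -> Defs.nondegenerate P.
Proof.
move=> PQ y; have /(congr1 (map_mx (evalC y))) := PQ.
by rewrite map_mxM map_mx1 => /mulmx1_unit[].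
Qed.

Lemma rhoD A X f g : rho A X (f + g) = rho A X f + rho A X g.
Proof. by rewrite /rho dyD mulrDr. Qed.

Lemma rhoB A X f g : rho A X (f - g) = rho A X f - rho A X g.
Proof. by rewrite /rho dyB mulrBr. Qed.

Lemma rhoM A X f g : rho A X (f * g) = f * rho A X g + rho A X f * g.
Proof. by rewrite /rho dyM; ring. Qed.

Lemma rho0 A X : rho A X 0 = 0.
Proof. by rewrite /rho dy0 mulr0. Qed.

Lemma rhoDl A X Y f : rho A (X + Y) f = rho A X f + rho A Y f.
Proof. by rewrite /rho mulmxDl mxE mulrDl. Qed.

Lemma rhoZl A X f g : rho A (f *: X) g = f * rho A X g.
Proof. by rewrite /rho -scalemxAl mxE mulrA. Qed.

Lemma bracketDl A : is_lie_algebroid A ->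
  forall X Y Z, bracket A (X + Y) Z = bracket A X Z + bracket A Y Z.
Proof.
by move=> lA X Y Z; have := bracket_linear lA 1 X Y Z; rewrite Cconst1 !scale1r.
Qed.

Lemma linear_form_expand (phi : sect R n -> K) :
    (forall f X Y, phi (f *: X + Y) = f * phi X + phi Y) ->
  forall X, phi X = \sum_i X 0 i * phi (delta_mx 0 i).
Proof.
move=> lin X.
have phiD Y Z : phi (Y + Z) = phi Y + phi Z.
  by have := lin 1 Y Z; rewrite scale1r mul1r.
have phi0 : phi 0 = 0 by apply: (addIr (phi 0)); rewrite -phiD !add0r.
rewrite [in LHS](row_sum_delta X) (big_morph phi phiD phi0).
apply: eq_bigr => i _.
by rewrite -[X in phi X]addr0 lin phi0 addr0.
Qed.

(** A projection, additive in w, onto the antisymmetric bivectors; keeping only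
    the pairs i < j gives each of these back without a factor 2. *)
Definition alt_part (w : form2 R n) : form2 R n := fun xi eta =>
  \sum_(i < n) \sum_(j < n | (i < j)%N)
     w (delta_mx 0 i) (delta_mx 0 j) * (xi 0 i * eta 0 j - xi 0 j * eta 0 i).

Lemma alt_part_bivector w : is_bivector (alt_part w).
Proof.
split=> [f xi eta zeta|xi]; last first.
  by rewrite /alt_part !big1 // => i _; rewrite big1 // => j _; ring.
rewrite /alt_part mulr_sumr -big_split; apply: eq_bigr => i _ /=.
rewrite mulr_sumr -big_split; apply: eq_bigr => j _ /=.
by rewrite !mxE; ring.
Qed.

Lemma alt_part_skew w : skew_symmetric (alt_part w).
Proof.
move=> xi eta; rewrite /alt_part -sumrN; apply: eq_bigr => i _.
by rewrite -sumrN; apply: eq_bigr => j _; ring.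
Qed.

Lemma alt_partD v w xi eta :
  alt_part (fun a b => v a b + w a b) xi eta
    = alt_part v xi eta + alt_part w xi eta.
Proof.
rewrite /alt_part -big_split; apply: eq_bigr => i _ /=.
by rewrite -big_split; apply: eq_bigr => j _; rewrite mulrDl.
Qed.

(** Antisymmetry turns linearity in the first argument into bilinearity, so w is
    determined by its values on pairs of basis sections, and the diagonal pairs
    contribute nothing. *)
Lemma alt_part_id w : is_bivector w -> skew_symmetric w -> alt_part w = w.
Proof.
move=> bw sw; apply/funext => xi; apply/funext => eta.
have expand zeta := linear_form_expand (w^~ zeta) (fun f a b => bw.1 f a b zeta).
pose F (i j : 'I_n) := xi 0 i * eta 0 j * w (delta_mx 0 i) (delta_mx 0 j).
have -> : w xi eta = \sum_(i < n) \sum_(j < n) F i j.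
  rewrite expand; apply: eq_bigr => i _.
  rewrite sw expand -sumrN mulr_sumr; apply: eq_bigr => j _.
  by rewrite -mulrN -sw mulrA.
have -> : \sum_(i < n) \sum_(j < n) F i j
    = \sum_(i < n) \sum_(j < n | (i < j)%N) F i j
      + \sum_(i < n) \sum_(j < n | (j < i)%N) F i j.
  rewrite -big_split; apply: eq_bigr => i _ /=.
  rewrite (bigID (fun j : 'I_n => (i < j)%N)) /=; congr (_ + _).
  rewrite (bigD1 i) ?ltnn //= /F bw.2 mulr0 add0r; apply: eq_bigl => j.
  by rewrite -leqNgt ltn_neqAle andbC.
rewrite /alt_part [X in _ + X](exchange_big_dep predT) //= -big_split.
apply: eq_bigr => i _ /=; rewrite -big_split; apply: eq_bigr => j _ /=.
by rewrite /F (sw (delta_mx 0 j)); ring.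
Qed.

(** L is the Lie derivative of sections of the dual bundle, that is, the
    transpose of minus the bracket, corrected by the anchor. *)
Definition dual_action P A (L : sect R n -> sect R n -> sect R n) : Prop :=
  forall X Y xi, pairing P Y (L X xi)
    = rho A X (pairing P Y xi) - pairing P (bracket A X Y) xi.

(** The Leibniz rule for the bracket cancels the derivative of f when Y is
    replaced by f Y in the defining equation, whose right-hand side is therefore a
    section of the dual of A; Q carries it to the bundle paired with A. *)
Lemma dual_action_exists P Q A : P *m Q = 1%:M ->
  is_lie_algebroid A -> skew_symmetric (bracket A) ->
  exists L, dual_action P A L.
Proof.
move=> PQ lA sA.
pose phi X xi Y := rho A X (pairing P Y xi) - pairing P (bracket A X Y) xi.
have phi_lin X xi f Y Z : phi X xi (f *: Y + Z) = f * phi X xi Y + phi X xi Z.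
  rewrite /phi sA (bracketDl _ lA) opprD -!sA (bracket_leibniz lA).
  by rewrite !(pairingDl, pairingZl) rhoD rhoM; ring_atoms.
exists (fun X xi => (Q *m \col_i phi X xi (delta_mx 0 i))^T) => X Y xi.
rewrite -[RHS]/(phi X xi Y) (linear_form_expand _ (phi_lin X xi)).
rewrite /pairing trmxK mulmxA -(mulmxA Y) PQ mulmx1 mxE.
by apply: eq_bigr => i _; rewrite mxE.
Qed.

Lemma dual_actionD P Q A L : P *m Q = 1%:M -> dual_action P A L ->
  forall X xi eta, L X (xi + eta) = L X xi + L X eta.
Proof.
move=> PQ dL X xi eta; apply: (pairing_inj _ _ _ _ PQ) => Y.
by rewrite pairingDr !dL !pairingDr rhoD; ring_atoms.
Qed.

Lemma dual_actionZ P Q A L : P *m Q = 1%:M -> dual_action P A L ->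
  forall X f xi, L X (f *: xi) = f *: L X xi + rho A X f *: xi.
Proof.
move=> PQ dL X f xi; apply: (pairing_inj _ _ _ _ PQ) => Y.
by rewrite pairingDr !pairingZr !dL !pairingZr rhoM; ring_atoms.
Qed.

Definition lie_derivative A (L : sect R n -> sect R n -> sect R n) X
    (w : form2 R n) : form2 R n :=
  fun xi eta => rho A X (w xi eta) - w (L X xi) eta - w xi (L X eta).

Lemma lie_derivative_bivector P Q A L X w :
  P *m Q = 1%:M -> dual_action P A L ->
  is_bivector w -> skew_symmetric w -> is_bivector (lie_derivative A L X w).
Proof.
move=> PQ dL [wlin walt] sw; split=> [f xi eta zeta|xi]; last first.
  by rewrite /lie_derivative walt rho0 (sw xi); ring.
rewrite /lie_derivative (dual_actionD _ _ _ _ PQ dL) (dual_actionZ _ _ _ _ PQ dL).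
by rewrite -(addrA (f *: _)) !wlin rhoD rhoM; ring.
Qed.

Lemma lie_derivative_wedge P A L X Y Z xi eta : dual_action P A L ->
  lie_derivative A L X (wedge P Y Z) xi eta
    = wedge P (bracket A X Y) Z xi eta + wedge P Y (bracket A X Z) xi eta.
Proof. by move=> dL; rewrite /lie_derivative /wedge !dL rhoB !rhoM; ring_atoms. Qed.

Lemma wedge_bivector P Y Z : is_bivector (wedge P Y Z).
Proof.
split=> [f xi eta zeta|xi]; rewrite /wedge; last by ring.
by rewrite !pairingDr !pairingZr; ring_atoms.
Qed.

Lemma wedge_skew P Y Z : skew_symmetric (wedge P Y Z).
Proof. by move=> xi eta; rewrite /wedge; ring_atoms. Qed.

(** The alternating part is needed for the value to satisfy [is_bivector]: on the
    diagonal the Lie derivative of w is - w(L_X xi, xi) - w(xi, L_X xi). *)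
Lemma lie_derivative_extends P Q A L : P *m Q = 1%:M -> dual_action P A L ->
  extends_bracket P A (fun X w => lie_derivative A L X (alt_part w)).
Proof.
move=> PQ dL; split.
- move=> X w _; apply: lie_derivative_bivector PQ dL _ _.
    exact: alt_part_bivector.
  exact: alt_part_skew.
- by move=> X v w _ _ xi eta; rewrite /lie_derivative !alt_partD rhoD; ring.
move=> X Y Z xi eta; rewrite alt_part_id; first exact: lie_derivative_wedge.
  exact: wedge_bivector.
exact: wedge_skew.
Qed.

Lemma delta_skew P B X :
  skew_symmetric (bracket B) -> skew_symmetric (delta P B X).
Proof.
by move=> sB xi eta; rewrite /delta sB -scaleN1r pairingZr; ring_atoms.
Qed.

Lemma delta_bivector P B X : is_lie_algebroid B -> skew_symmetric (bracket B) ->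
  is_bivector (delta P B X).
Proof.
move=> lB sB; split=> [f xi eta zeta|xi]; rewrite /delta; last first.
  by rewrite bracket_alternating // -(scale0r 0) pairingZr; ring.
rewrite (bracketDl _ lB) (sB (f *: xi)) (bracket_leibniz lB) (sB zeta).
rewrite !pairingDr -!scaleN1r !(pairingZr, pairingDr) rhoDl rhoZl rhoD rhoM.
by ring_atoms.
Qed.

Lemma lie_bialgebroid_criterion P Q A B :
    P *m Q = 1%:M -> is_lie_algebroid A -> is_lie_algebroid B ->
    skew_symmetric (bracket A) -> skew_symmetric (bracket B) ->
    (forall L, dual_action P A L -> forall X Y xi eta,
       delta P B (bracket A X Y) xi eta
         = lie_derivative A L X (delta P B Y) xi eta
           - lie_derivative A L Y (delta P B X) xi eta) ->
  lie_bialgebroid P A B.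
Proof.
move=> PQ lA lB sA sB cocycle; split=> //.
  exact: right_inverse_nondegenerate PQ.
have [L dL] := dual_action_exists _ _ _ PQ lA sA.
exists (fun X w => lie_derivative A L X (alt_part w)); split.
  exact: lie_derivative_extends PQ dL.
have dE X : alt_part (delta P B X) = delta P B X.
  by apply: alt_part_id; [exact: delta_bivector|exact: delta_skew].
by move=> X Y xi eta; rewrite !dE (cocycle L dL) addrC.
Qed.

End LieDerivative.

Arguments dual_action {R n}.
Arguments lie_derivative {R n}.

(** * Coordinates in the dual frames *)

Section Frames.
Variable R : realType.
Local Notation K := (Cinf R).

Definition Jsec (x0 x1 x2 x3 : K) : sect R 4 := \row_k [:: x0; x1; x2; x3]`_k.

Definition Jhatsec (u0 u1 u2 u3 : K) : sect R (3 + 1) :=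
  row_mx (\row_k [:: u1; u2; u3]`_k) (2%:R * u0)%:M.

Lemma Jsec_frame x0 x1 x2 x3 : Jsec x0 x1 x2 x3 =
  x0 *: J R 0 + x1 *: J R (inord 1) + x2 *: J R (inord 2) + x3 *: J R (inord 3).
Proof.
apply/rowP => -[[|[|[|[|//]]]] k4];
  by rewrite /J !mxE !eqxx /= -!val_eqE /= !inordK //=; ring.
Qed.

Lemma Jhatsec_frame u0 u1 u2 u3 : Jhatsec u0 u1 u2 u3 =
  u0 *: Jhat R 0 + u1 *: Jhat R (inord 1) + u2 *: Jhat R (inord 2)
    + u3 *: Jhat R (inord 3).
Proof.
have liftE (k : 'I_3) : inord k.+1 = lift ord0 k :> 'I_4.
  by apply/val_inj; rewrite /= inordK // ltnS.
have h1 := liftE 0; have h2 := liftE (inord 1); have h3 := liftE (inord 2).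
rewrite !inordK //= in h2 h3.
rewrite h1 h2 h3 /Jhat !liftK unlift_none !scale_row_mx !add_row_mx.
rewrite !scaler0 !add0r !addr0.
congr row_mx; last by rewrite scale_scalar_mx mulrC.
apply/rowP => -[[|[|[|//]]] k3];
  by rewrite !mxE !eqxx /= -!val_eqE /= ?inordK //=; ring.
Qed.

Lemma JsecP (X : sect R 4) : exists x0 x1 x2 x3, X = Jsec x0 x1 x2 x3.
Proof.
exists (X 0 0), (X 0 (inord 1)), (X 0 (inord 2)), (X 0 (inord 3)).
apply/rowP => -[[|[|[|[|//]]]] k4]; rewrite !mxE /=; congr (X _ _);
  by apply/val_inj; rewrite /= ?inordK.
Qed.

Lemma JhatsecP (X : sect R (3 + 1)) : exists u0 u1 u2 u3, X = Jhatsec u0 u1 u2 u3.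
Proof.
pose a := lsubmx X.
exists (Cconst (2%:R^-1 : R) * rsubmx X 0 0).
exists (a 0 0), (a 0 (inord 1)), (a 0 (inord 2)).
rewrite /Jhatsec mulrCA mulrA Cconst_half mul1r -[LHS]hsubmxK.
congr row_mx; last exact: mx11_scalar.
apply/rowP => -[[|[|[|//]]] k3]; rewrite -/a [RHS]mxE /=; congr (a _ _);
  by apply/val_inj; rewrite /= ?inordK.
Qed.

Lemma JsecD x0 x1 x2 x3 y0 y1 y2 y3 :
  Jsec x0 x1 x2 x3 + Jsec y0 y1 y2 y3
    = Jsec (x0 + y0) (x1 + y1) (x2 + y2) (x3 + y3).
Proof. by apply/rowP => -[[|[|[|[|//]]]] k4]; rewrite !mxE. Qed.

Lemma JsecZ f x0 x1 x2 x3 :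
  f *: Jsec x0 x1 x2 x3 = Jsec (f * x0) (f * x1) (f * x2) (f * x3).
Proof. by apply/rowP => -[[|[|[|[|//]]]] k4]; rewrite !mxE. Qed.

Lemma JsecN x0 x1 x2 x3 : - Jsec x0 x1 x2 x3 = Jsec (- x0) (- x1) (- x2) (- x3).
Proof. by rewrite -scaleN1r JsecZ !mulN1r. Qed.

Lemma Jsec0 : 0 = Jsec 0 0 0 0 :> sect R 4.
Proof. by rewrite -(scale0r (Jsec 0 0 0 0)) JsecZ !mul0r. Qed.

Lemma JhatsecD u0 u1 u2 u3 v0 v1 v2 v3 :
  Jhatsec u0 u1 u2 u3 + Jhatsec v0 v1 v2 v3
    = Jhatsec (u0 + v0) (u1 + v1) (u2 + v2) (u3 + v3).
Proof.
rewrite /Jhatsec add_row_mx; congr row_mx; last by rewrite -raddfD mulrDr.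
by apply/rowP => -[[|[|[|//]]] k3]; rewrite !mxE.
Qed.

Lemma JhatsecZ f u0 u1 u2 u3 :
  f *: Jhatsec u0 u1 u2 u3 = Jhatsec (f * u0) (f * u1) (f * u2) (f * u3).
Proof.
rewrite /Jhatsec scale_row_mx; congr row_mx; last first.
  by rewrite scale_scalar_mx mulrCA.
by apply/rowP => -[[|[|[|//]]] k3]; rewrite !mxE.
Qed.

Lemma JhatsecN u0 u1 u2 u3 :
  - Jhatsec u0 u1 u2 u3 = Jhatsec (- u0) (- u1) (- u2) (- u3).
Proof. by rewrite -scaleN1r JhatsecZ !mulN1r. Qed.

Lemma Jhatsec0 : 0 = Jhatsec 0 0 0 0 :> sect R (3 + 1).
Proof. by rewrite -(scale0r (Jhatsec 0 0 0 0)) JhatsecZ !mul0r. Qed.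

Lemma frames_dual_pairing P x0 x1 x2 x3 u0 u1 u2 u3 : frames_dual P ->
  pairing P (Jsec x0 x1 x2 x3) (Jhatsec u0 u1 u2 u3)
    = x0 * u0 + x1 * u1 + x2 * u2 + x3 * u3.
Proof.
move=> fP; rewrite Jsec_frame Jhatsec_frame.
rewrite !(pairingDl, pairingDr, pairingZl, pairingZr) !fP.
by rewrite -!val_eqE /= !inordK //=; ring.
Qed.

Definition Jhat_mx : 'M[K]_4 := \matrix_(k, j) Jhat R j 0 k.

Lemma frames_dualE (P : 'M[K]_4) : frames_dual P <-> P *m Jhat_mx = 1%:M.
Proof.
have pE i j : pairing P (J R i) (Jhat R j) = (P *m Jhat_mx) i j.
  by rewrite /pairing /J -rowE !mxE; apply: eq_bigr => k _; rewrite !mxE.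
split=> [fP|PQ i j]; last by rewrite pE PQ mxE.
by apply/matrixP => i j; rewrite -pE fP mxE.
Qed.

(** The last standard basis vector is d/dy, which is half of Jhat_0. *)
Definition frame_pairing : 'M[K]_4 :=
  row_mx (\matrix_(i < 4, k < 3) (i == lift ord0 k)%:R)
         (\col_(i < 4) (Cconst (2%:R^-1 : R) * (i == 0)%:R)).

Lemma frame_pairing_dual : frames_dual frame_pairing.
Proof.
move=> i j; rewrite /pairing /J -rowE.
pose p : 'rV[K]_(3 + 1) := row_mx (\row_k (i == lift ord0 k)%:R)
  (Cconst (2%:R^-1 : R) * (i == 0)%:R)%:M.
have -> : row i frame_pairing = p.
  apply/rowP => k; rewrite !mxE; case: (fintype.split _) => l; rewrite !mxE //.
  by rewrite (ord1 l) eqxx.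
rewrite -[LHS]/((p *m (Jhat R j)^T) 0 0) /p /Jhat.
case: (unliftP ord0 j) => [k|] ->; rewrite tr_row_mx mul_row_col.
  by rewrite !trmx_delta !trmx0 mulmx0 addr0 -colE !mxE.
rewrite trmx0 mulmx0 add0r tr_scalar_mx mul_mx_scalar !mxE.
by rewrite mulrA [2%:R * _]mulrC Cconst_half mul1r.
Qed.

Lemma frames_dual_unique (P Q : 'M[K]_4) : frames_dual P -> frames_dual Q -> P = Q.
Proof.
move=> /frames_dualE PJ /frames_dualE /mulmx1C JQ.
by rewrite -[P]mulmx1 -JQ mulmxA PJ mul1mx.
Qed.

End Frames.

Arguments Jsec {R}.
Arguments Jhatsec {R}.

(** * The two Lie algebroids *)

Section Algebroids.
Variable R : realType.

Lemma Jsec_bracket x0 x1 x2 x3 y0 y1 y2 y3 :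
  bracket (A_R R) (Jsec x0 x1 x2 x3) (Jsec y0 y1 y2 y3) =
  Jsec (2%:R * (x2 * y3 - x3 * y2)) (2%:R * ycoord R * (x2 * y3 - x3 * y2))
       (2%:R * (x3 * y1 - x1 * y3)) (2%:R * (x1 * y2 - x2 * y1)).
Proof. by apply/rowP => k; rewrite !mxE /= !inordK. Qed.

Lemma rho_A_R X f : rho (A_R R) X f = 0.
Proof. by rewrite /rho mulmx0 mxE mul0r. Qed.

Lemma Jhatsec_bracket u0 u1 u2 u3 v0 v1 v2 v3 :
  bracket (B_R R) (Jhatsec u0 u1 u2 u3) (Jhatsec v0 v1 v2 v3) =
  Jhatsec (2%:R * (u0 * dy v0 - v0 * dy u0))
          (2%:R * (u0 * dy v1 - v0 * dy u1))
          (u1 * v2 - u2 * v1 + 2%:R * (u0 * dy v2 - v0 * dy u2))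
          (u1 * v3 - u3 * v1 + 2%:R * (u0 * dy v3 - v0 * dy u3)).
Proof.
rewrite /Jhatsec /= !row_mxKl !row_mxKr !mxE eqxx !mulr1n; congr row_mx.
  apply/rowP => k; rewrite !mxE /= !inordK //=.
  by case: k => -[|[|[|//]]] kk /=; ring.
by congr _%:M; rewrite !dyE; ring.
Qed.

Lemma rho_Jhatsec u0 u1 u2 u3 f :
  rho (B_R R) (Jhatsec u0 u1 u2 u3) f = 2%:R * u0 * dy f.
Proof. by rewrite /rho /Jhatsec mul_row_col mulmx0 add0r mulmx1 mxE eqxx. Qed.

Lemma skew_A_R : skew_symmetric (bracket (A_R R)).
Proof.
move=> X Y; have [x0 [x1 [x2 [x3 ->]]]] := JsecP _ X.
have [y0 [y1 [y2 [y3 ->]]]] := JsecP _ Y.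
by rewrite !Jsec_bracket JsecN; congr Jsec; differential_ring.
Qed.

Lemma skew_B_R : skew_symmetric (bracket (B_R R)).
Proof.
move=> X Y; have [x0 [x1 [x2 [x3 ->]]]] := JhatsecP _ X.
have [y0 [y1 [y2 [y3 ->]]]] := JhatsecP _ Y.
by rewrite !Jhatsec_bracket JhatsecN; congr Jhatsec; differential_ring.
Qed.

Lemma lie_algebroid_A_R : is_lie_algebroid (A_R R).
Proof.
split=> [c X Y Z|X|X Y Z|X Y f];
  have [x0 [x1 [x2 [x3 ->]]]] := JsecP _ X;
  try (have [y0 [y1 [y2 [y3 ->]]]] := JsecP _ Y);
  try (have [z0 [z1 [z2 [z3 ->]]]] := JsecP _ Z);
  rewrite ?rho_A_R ?Jsec0 !(Jsec_bracket, JsecZ, JsecD);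
  by congr Jsec; differential_ring.
Qed.

Lemma lie_algebroid_B_R : is_lie_algebroid (B_R R).
Proof.
split=> [c X Y Z|X|X Y Z|X Y f];
  have [x0 [x1 [x2 [x3 ->]]]] := JhatsecP _ X;
  try (have [y0 [y1 [y2 [y3 ->]]]] := JhatsecP _ Y);
  try (have [z0 [z1 [z2 [z3 ->]]]] := JhatsecP _ Z);
  rewrite ?rho_Jhatsec ?Jhatsec0 !(Jhatsec_bracket, JhatsecZ, JhatsecD);
  by congr Jhatsec; differential_ring.
Qed.

(** * The cocycle identities *)

Variable P : 'M[Cinf R]_4.
Hypothesis fP : frames_dual P.

Let PJ : P *m Jhat_mx R = 1%:M.
Proof. by apply/frames_dualE. Qed.

Let PtrJ : P^T *m (Jhat_mx R)^T = 1%:M.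
Proof. by rewrite -trmx_mul mulmx1C // trmx1. Qed.

(** No derivative occurs because the anchor vanishes: this is the fibrewise
    coadjoint action. *)
Lemma dual_action_A_R L : dual_action P (A_R R) L ->
  forall x0 x1 x2 x3 u0 u1 u2 u3,
  L (Jsec x0 x1 x2 x3) (Jhatsec u0 u1 u2 u3) =
  Jhatsec 0 (2%:R * (x2 * u3 - x3 * u2))
            (2%:R * (x3 * (u0 + ycoord R * u1) - x1 * u3))
            (2%:R * (x1 * u2 - x2 * (u0 + ycoord R * u1))).
Proof.
move=> dL x0 x1 x2 x3 u0 u1 u2 u3; apply: (pairing_inj _ _ _ _ _ _ PJ) => Z.
have [z0 [z1 [z2 [z3 ->]]]] := JsecP _ Z.
by rewrite dL rho_A_R Jsec_bracket !frames_dual_pairing //; ring.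
Qed.

Lemma dual_action_B_R L : dual_action P^T (B_R R) L ->
  forall x0 x1 x2 x3 u0 u1 u2 u3,
  L (Jhatsec u0 u1 u2 u3) (Jsec x0 x1 x2 x3) =
  Jsec (2%:R * (u0 * dy x0 + x0 * dy u0 + x1 * dy u1 + x2 * dy u2 + x3 * dy u3))
       (2%:R * u0 * dy x1 + x2 * u2 + x3 * u3)
       (2%:R * u0 * dy x2 - x2 * u1)
       (2%:R * u0 * dy x3 - x3 * u1).
Proof.
move=> dL x0 x1 x2 x3 u0 u1 u2 u3; apply: (pairing_inj _ _ _ _ _ _ PtrJ) => Z.
have [z0 [z1 [z2 [z3 ->]]]] := JhatsecP _ Z.
rewrite dL Jhatsec_bracket !pairing_tr !frames_dual_pairing // rho_Jhatsec.
by differential_ring.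
Qed.

Lemma delta_Jsec x0 x1 x2 x3 u0 u1 u2 u3 v0 v1 v2 v3 :
  delta P (B_R R) (Jsec x0 x1 x2 x3) (Jhatsec u0 u1 u2 u3) (Jhatsec v0 v1 v2 v3) =
  x2 * (u1 * v2 - u2 * v1) + x3 * (u1 * v3 - u3 * v1)
  - 2%:R * (dy x1 * (u0 * v1 - u1 * v0) + dy x2 * (u0 * v2 - u2 * v0)
            + dy x3 * (u0 * v3 - u3 * v0)).
Proof.
rewrite /delta !rho_Jhatsec Jhatsec_bracket !frames_dual_pairing //.
by differential_ring.
Qed.

Lemma delta_Jhatsec u0 u1 u2 u3 x0 x1 x2 x3 y0 y1 y2 y3 :
  delta P^T (A_R R) (Jhatsec u0 u1 u2 u3) (Jsec x0 x1 x2 x3) (Jsec y0 y1 y2 y3) =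
  2%:R * ((u0 + ycoord R * u1) * (x2 * y3 - x3 * y2) + u2 * (x3 * y1 - x1 * y3)
     + u3 * (x1 * y2 - x2 * y1)).
Proof.
rewrite /delta !rho_A_R Jsec_bracket !pairing_tr !frames_dual_pairing //.
by ring.
Qed.

Lemma lie_bialgebroid_A_R : lie_bialgebroid P (A_R R) (B_R R).
Proof.
apply: (lie_bialgebroid_criterion _ _ _ _ _ _ PJ lie_algebroid_A_R
  lie_algebroid_B_R skew_A_R skew_B_R) => L dL X Y xi eta.
have [x0 [x1 [x2 [x3 ->]]]] := JsecP _ X.
have [y0 [y1 [y2 [y3 ->]]]] := JsecP _ Y.
have [u0 [u1 [u2 [u3 ->]]]] := JhatsecP _ xi.
have [v0 [v1 [v2 [v3 ->]]]] := JhatsecP _ eta.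
rewrite /lie_derivative !rho_A_R !(dual_action_A_R _ dL) Jsec_bracket !delta_Jsec.
by differential_ring.
Qed.

Lemma lie_bialgebroid_B_R : lie_bialgebroid P^T (B_R R) (A_R R).
Proof.
apply: (lie_bialgebroid_criterion _ _ _ _ _ _ PtrJ lie_algebroid_B_R
  lie_algebroid_A_R skew_B_R skew_A_R) => L dL X Y xi eta.
have [u0 [u1 [u2 [u3 ->]]]] := JhatsecP _ X.
have [v0 [v1 [v2 [v3 ->]]]] := JhatsecP _ Y.
have [x0 [x1 [x2 [x3 ->]]]] := JsecP _ xi.
have [y0 [y1 [y2 [y3 ->]]]] := JsecP _ eta.
rewrite /lie_derivative !(dual_action_B_R _ dL) Jhatsec_bracket !delta_Jhatsec.
by rewrite !rho_Jhatsec; differential_ring.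
Qed.

End Algebroids.

Theorem proposition2p4 (R : realType) :
  (exists! P : 'M[Cinf R]_4, frames_dual P) /\
  (forall P : 'M[Cinf R]_4, frames_dual P ->
     lie_bialgebroid P (A_R R) (B_R R) /\
     lie_bialgebroid P^T (B_R R) (A_R R)).
Proof.
split=> [|P fP].
  exists (frame_pairing R); split=> [|P fP]; first exact: frame_pairing_dual.
  exact: frames_dual_unique (frame_pairing_dual R) fP.
by split; [exact: lie_bialgebroid_A_R | exact: lie_bialgebroid_B_R].
Qed.
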